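(* Fix $\kappa\ge 1$. There exist constants $\kappa_0,\kappa_1,\kappa_2>0$ depending only on $\kappa$ such that the following holds. Consider the one-dimensional grid ($d=1$) with storage capacity $S=0$ and line capacity $C>0$, and let the net generations $Z_i(t)$ be i.i.d. over $i\in\mathbb{Z}$ and $t\ge 0$, with common distribution in $\mathcal{S}(\kappa)$, mean $\mu\ge 0$ and variance $\sigma^2>0$. If $\mu<\kappa_0\sigma$ and $\sigma<\kappa_0 C$, then every control scheme satisfies \[ \liminf_{n\to\infty}\epsilon_{\rm tot}(n)\ \ge\ \begin{cases}\kappa_1\,\sigma^2/C & \text{if } \mu<\sigma^2/C,\\[2pt] \mu\,\exp\{-\kappa_2\,\mu C/\sigma^2\} & \text{otherwise.}\end{cases} \]
   Context: Sub-Gaussian class: a real random variable $X$ is sub-Gaussian with tail parameter $s^2$ if $\mathbb{E}\,e^{\lambda(X-\mathbb{E}X)}\le e^{\lambda^2s^2/2}$ for all $\lambda\in\mathbb{R}$. For $\kappa>0$, $\mathcal{S}(\kappa)$ is the class of distributions with variance $\sigma^2>0$ that are sub-Gaussian with some tail parameter $s^2$ satisfying $1\le s^2/\sigma^2<\kappa$ (Gaussian distributions belong to $\mathcal{S}(\kappa)$ for every $\kappa>1$). Grid model: the vertex set is $\mathbb{Z}^d$; the edge set $E$ consists of nearest-neighbour pairs, each given a fixed orientation $e=(i,k)$. There is a storage capacity $S\ge0$ at every node and a line capacity $C>0$ on every edge. Time is $t\in\{0,1,2,\dots\}$ and $Z_i(t)$ is the net generation (production minus demand) at node $i$ in slot $t$.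 A control scheme is any family of real random variables $Y_i(t)$ (energy put into storage), $W_i(t)$ (fast generation; negative values mean energy drawn from backup generation, positive values mean energy dumped), $B_i(t)$ (stored energy) and $F_e(t)$ (line flows), defined on the same probability space as the $Z$'s (arbitrary dependence allowed), such that for all $i,t$: $B_i(0)=0$, $B_i(t+1)=B_i(t)+Y_i(t)$, $0\le B_i(t)\le S$, and the energy balance $Z_i(t)-Y_i(t)-W_i(t)=\sum_{e=(i,k)\in E}F_e(t)-\sum_{e=(k,i)\in E}F_e(t)$. For $n\ge1$ let $\Lambda_n=\{0,\dots,n-1\}^d$, $E_n$ the set of edges with both endpoints in $\Lambda_n$, $x_-=\max(-x,0)$, $x_+=\max(x,0)$, and \[ \epsilon_{\rm tot}(n)=\frac{1}{n|\Lambda_n|}\sum_{t=0}^{n-1}\sum_{i\in\Lambda_n}\mathbb{E}\big[(W_i(t))_-\big]+\frac{1}{n|E_n|}\sum_{t=0}^{n-1}\sum_{e\in E_n}\mathbb{E}\big[(F_e(t)-C)_++(-C-F_e(t))_+\big]. \] *)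

(* Defs.v *)
From HB Require Import structures.
From mathcomp Require Import all_boot all_order all_algebra.
From mathcomp Require Import all_classical all_reals all_analysis.
Set Implicit Arguments. Unset Strict Implicit. Unset Printing Implicit Defensive.
Import Order.TTheory GRing.Theory Num.Theory.
Local Open Scope classical_set_scope.
Local Open Scope ring_scope.

Section defs.
Context {d : measure_display} {T : measurableType d} {R : realType}.
Variable P : probability T R.

Definition pospart (x : R) : R := Num.max x 0.
Definition negpart (x : R) : R := Num.max (- x) 0.

Definition subgaussian (X : T -> R) (s2 : R) : Prop :=
  P.-integrable setT (EFin \o X) /\
  forall lam : R,
    ('E_P[fun w => expR (lam * (X w - fine 'E_P[X]))] <= (expR (lam ^+ 2 * s2 / 2))%:E)%E.

Definition in_S (kappa : R) (X : T -> R) : Prop :=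
  exists sigma2 s2 : R,
    'V_P[X] = sigma2%:E /\ 0 < sigma2 /\ subgaussian X s2 /\
    1 <= s2 / sigma2 /\ s2 / sigma2 < kappa.

Definition mutually_independent (I : eqType) (X : I -> T -> R) : Prop :=
  forall (J : seq I) (B : I -> set R), uniq J ->
    (forall j, measurable (B j)) ->
    P (\big[setI/setT]_(j <- J) (X j @^-1` B j)) =
    (\prod_(j <- J) P (X j @^-1` B j))%E.

Definition same_distribution (X Y : T -> R) : Prop :=
  forall A : set R, measurable A -> P (X @^-1` A) = P (Y @^-1` A).

(** Control scheme on the one-dimensional grid Z with storage capacity S.
    Edge e_i joins nodes i and i+1; it is oriented (i,i+1) if [o i] and
    (i+1,i) otherwise.  F i t is the flow on e_i at time t. *)
Definition orient_sign (o : int -> bool) (i : int) : R := if o i then 1 else -1.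

Definition control_scheme (S : R) (o : int -> bool) (Z : int -> nat -> T -> R)
  (Y W B F : int -> nat -> T -> R) : Prop :=
  (forall i t, measurable_fun setT (Y i t)) /\
  (forall i t, measurable_fun setT (W i t)) /\
  (forall i t, measurable_fun setT (B i t)) /\
  (forall i t, measurable_fun setT (F i t)) /\
  (forall i w, B i 0%N w = 0) /\
  (forall i t w, B i t.+1 w = B i t w + Y i t w) /\
  (forall i t w, 0 <= B i t w <= S) /\
  (forall i t w, Z i t w - Y i t w - W i t w =
      orient_sign o i * F i t w - orient_sign o (i - 1) * F (i - 1) t w).

(** epsilon_tot(n) for d = 1: Lambda_n = {0,...,n-1}, |Lambda_n| = n,
    E_n = {e_0,...,e_{n-2}}, |E_n| = n - 1. *)
Definition eps_tot (C : R) (W F : int -> nat -> T -> R) (n : nat) : \bar R :=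
  (((n%:R * n%:R)^-1)%:E *
     \sum_(t < n) \sum_(i < n) 'E_P[fun w => negpart (W (i%:Z) t w)] +
   ((n%:R * (n.-1)%:R)^-1)%:E *
     \sum_(t < n) \sum_(i < n.-1)
        'E_P[fun w => (pospart (F (i%:Z) t w - C) + pospart (- C - F (i%:Z) t w))%R])%E.

End defs.

(* Main.v *)
Require Import Defs.
From HB Require Import structures.
From mathcomp Require Import all_boot all_order all_algebra.
From mathcomp Require Import all_classical all_reals all_analysis.
From mathcomp Require Import measurable_realfun ring lra zify.
Import Order.TTheory GRing.Theory Num.Theory.
Local Open Scope classical_set_scope.
Local Open Scope ring_scope.

(** Without storage the time slots decouple.  Cut the line into blocks of [m]
    nodes.  The energy missing in a block must be imported through its two
    boundary edges or drawn from backup, so on the event that the net generation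
    of the block is at most [- 3 C] the cost incurred in the block and on its
    boundary is at least [C].  Hence the total cost is at least of order
    [C / m * p], where [p] is the probability of that event.

    With [nu = max mu (sigma^2 / C)] and [m] of order [C / nu], [p] is bounded
    below by applying the Paley-Zygmund inequality to [exp (- lam (S_m - m mu))]
    with [lam = 100 nu / sigma^2]: the second moment is controlled by the
    sub-Gaussian hypothesis, and the first moment is at least
    [exp (m lam^2 sigma^2 / 16)] since [lam sigma] is small.  This gives
    [p >= exp (- 40000 kappa nu C / sigma^2) / 4]. *)

(** * Expectation of a product of functions of independent variables *)

Section product_formula.
Context {d : measure_display} {T : measurableType d} {R : realType}.
Variable P : probability T R.
Local Open Scope ereal_scope.
Import HBNNSimple.

(** The last hypothesis is the trace of independence of [G] and [X] on events of [X], with [K] in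
    the role of the mean of [G]. Linearity over the level sets of [h] carries it to simple
    functions; levels [y < 0] have empty preimage. *)
Lemma integral_mul_nnsfun_comp (G X : T -> R) (K : \bar R)
    (h : {nnsfun R >-> R}) :
  measurable_fun setT G -> (forall w, (0 <= G w)%R) -> measurable_fun setT X ->
  (forall B, measurable B ->
    \int[P]_w (G w * \1_B (X w))%:E = K * P (X @^-1` B)) ->
  \int[P]_w (G w * h (X w))%:E =
  \sum_(y \in range h) y%:E * (K * P (X @^-1` (h @^-1` [set y]))).
Proof.
move=> mG G0 mX GK.
have mX' B : measurable B -> measurable (X @^-1` B).
  by move=> mB; rewrite -[_ @^-1` _]setTI; exact: mX.
have m1 y : measurable_fun setT (fun w => \1_(h @^-1` [set y]) (X w) : R).
  by apply: measurableT_comp => //.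
transitivity (\int[P]_w
    \sum_(y \in range h) ((y * \1_(h @^-1` [set y]) (X w))%:E * (G w)%:E)).
  apply: eq_integral => w _; rewrite mulrC EFinM fimfunE -fsumEFin//.
  rewrite muleC ge0_mule_fsumr; last first.
    by move=> y; rewrite EFinM nnfun_muleindic_ge0.
  by apply: eq_fsbigr => y _; rewrite muleC.
rewrite ge0_integral_fsum//; last 2 first.
- by move=> y; apply: emeasurable_funM; apply/measurable_EFinP => //;
    apply: measurable_funM.
- by move=> y w _; rewrite mule_ge0 ?lee_fin// -lee_fin EFinM nnfun_muleindic_ge0.
apply: eq_fsbigr => y _.
have [y0|y0] := leP 0%R y.
  rewrite -GK// -ge0_integralZl_EFin//.
  - by apply: eq_integral => w _; rewrite -!EFinM mulrAC mulrA.
  - by move=> w _; rewrite lee_fin mulr_ge0.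
  - by apply/measurable_EFinP; apply: measurable_funM.
rewrite preimage_nnfun0// preimage_set0 measure0 !mule0.
by rewrite integral0_eq// => w _; rewrite indic0 mulr0 mul0e.
Qed.

(** Monotone convergence along simple approximations of [f] extends the factorisation from
    indicators. *)
Lemma integral_mul_comp (G X : T -> R) (K : \bar R) (f : R -> R) :
  K \is a fin_num -> 0 <= K ->
  measurable_fun setT G -> (forall w, (0 <= G w)%R) -> measurable_fun setT X ->
  (forall B, measurable B ->
    \int[P]_w (G w * \1_B (X w))%:E = K * P (X @^-1` B)) ->
  measurable_fun setT f -> (forall x, (0 <= f x)%R) ->
  \int[P]_w (G w * f (X w))%:E = K * \int[P]_w (f (X w))%:E.
Proof.
move=> Kfin K0 mG G0 mX GK mf f0.
have mEf : measurable_fun setT (EFin \o f) by exact/measurable_EFinP.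
pose f_ := nnsfun_approx measurableT mEf.
have nd x : nondecreasing_seq (fun n => f_ n x).
  by move=> m n mn; exact/lefP/nd_nnsfun_approx.
have lim_ (H : T -> R) : measurable_fun setT H -> (forall w, (0 <= H w)%R) ->
    \int[P]_w (H w * f (X w))%:E = limn (fun n => \int[P]_w (H w * f_ n (X w))%:E).
  move=> mH H0; rewrite -monotone_convergence//.
  - apply: eq_integral => w _; apply/esym/cvg_lim => //.
    rewrite EFinM; under eq_fun do rewrite EFinM.
    apply: cvgeZl => //.
    by apply: (@cvg_nnsfun_approx _ _ _ setT measurableT _ mEf) => //= x _;
      rewrite lee_fin.
  - by move=> n; apply/measurable_EFinP; apply: measurable_funM => //;
      apply: measurableT_comp.
  - by move=> n w _; rewrite lee_fin mulr_ge0.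
  - by move=> w _ m n mn; rewrite lee_fin ler_wpM2l//; exact: nd.
(* The right-hand integral is treated as the case [G = 1], [K = 1], so that both sides become limits
   of the same finite sums. *)
have G1 B : measurable B ->
    \int[P]_w (cst 1%R w * \1_B (X w))%:E = 1 * P (X @^-1` B).
  move=> mB; have mXB : measurable (X @^-1` B).
    by rewrite -[_ @^-1` _]setTI; exact: mX.
  under eq_integral do rewrite /= mul1r.
  by rewrite mul1e -[in RHS](setIT (X @^-1` B)) -integral_indic.
rewrite (lim_ G)//.
transitivity (K * \int[P]_w (cst 1%R w * f (X w))%:E); last first.
  by congr (_ * _); apply: eq_integral => w _; rewrite /= mul1r.
rewrite (lim_ (cst 1%R))// -limeMl//.
  congr (limn _); apply/funext => n /=.
  rewrite (@integral_mul_nnsfun_comp _ X K)//.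
  rewrite (@integral_mul_nnsfun_comp _ X 1)//.
  rewrite ge0_mule_fsumr.
    by apply: eq_fsbigr => y _; rewrite mul1e muleCA.
  move=> y; have [y0|y0] := leP 0%R y; first by rewrite mule_ge0 ?mule_ge0.
  by rewrite preimage_nnfun0// preimage_set0 measure0 !mule0.
apply: ereal_nondecreasing_is_cvgn => a b ab; apply: ge0_le_integral => //.
- by move=> w _; rewrite lee_fin mulr_ge0.
- by apply/measurable_EFinP; apply: measurable_funM => //; apply: measurableT_comp.
- by apply/measurable_EFinP; apply: measurable_funM => //; apply: measurableT_comp.
- by move=> w _; rewrite lee_fin /= !mul1r; exact: nd.
Qed.

Lemma prod_indic (I : Type) (B : I -> set T) (J : seq I) w :
  (\prod_(j <- J) \1_(B j) w)%R = \1_(\big[setI/setT]_(j <- J) B j) w :> R.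
Proof.
elim: J => [|j J IH]; first by rewrite !big_nil indicT.
by rewrite !big_cons IH indicI.
Qed.

(* Indicators are traded for general functions one variable at a time. *)
Lemma integral_prod_indep_mixed (I : eqType) (X : I -> T -> R)
    (f : I -> R -> R) (J1 J2 : seq I) (B : I -> set R) :
  mutually_independent P X -> (forall i, measurable_fun setT (X i)) ->
  (forall i, measurable_fun setT (f i)) -> (forall i x, (0 <= f i x)%R) ->
  (forall i, \int[P]_w (f i (X i w))%:E < +oo) ->
  uniq (J1 ++ J2) -> (forall j, measurable (B j)) ->
  \int[P]_w (\prod_(j <- J1) f j (X j w) *
             \prod_(j <- J2) \1_(X j @^-1` B j) w)%:E =
  (\prod_(j <- J1) \int[P]_w (f j (X j w))%:E) *
  \prod_(j <- J2) P (X j @^-1` B j).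
Proof.
move=> indep mX mf f0 ffin.
have mXB i A : measurable A -> measurable (X i @^-1` A).
  by move=> mA; rewrite -[_ @^-1` _]setTI; exact: mX.
elim: J1 J2 B => [|j J1 IH] J2 B /= uJ mB.
  rewrite big_nil mul1e -indep//.
  under eq_integral do rewrite big_nil mul1r prod_indic.
  rewrite integral_indic ?setIT//.
  by elim: (J2) => [|k J IHJ]; rewrite ?big_nil// big_cons; apply: measurableI => //;
    exact: mXB.
pose G w := (\prod_(i <- J1) f i (X i w) * \prod_(i <- J2) \1_(X i @^-1` B i) w)%R.
pose K := \prod_(i <- J1) \int[P]_w (f i (X i w))%:E * \prod_(i <- J2) P (X i @^-1` B i).
have mG : measurable_fun setT G.
  apply: measurable_funM; apply: measurable_prod => i _.
    by apply: measurableT_comp.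
  by apply: measurable_indic; exact: mXB.
rewrite (_ : integral _ _ _ = \int[P]_w (G w * f j (X j w))%:E); last first.
  by apply: eq_integral => w _; rewrite big_cons /G; congr EFin; ring.
have j_notin : j \notin J1 ++ J2 by case/andP: uJ.
have uJ12 : uniq (J1 ++ J2) by case/andP: uJ.
rewrite (@integral_mul_comp _ (X j) K (f j))//.
- by rewrite big_cons /K muleC muleA.
- rewrite /K fin_numM//.
    apply: prode_fin_num => i _; rewrite ge0_fin_numE//.
    by apply: integral_ge0 => w _; rewrite lee_fin.
  by apply: prode_fin_num => i _; apply: fin_num_measure; exact: mXB.
- rewrite mule_ge0//; apply: prode_ge0 => i _ //.
  by apply: integral_ge0 => w _; rewrite lee_fin.
- by move=> w; rewrite mulr_ge0//; apply: prodr_ge0.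
(* The induction hypothesis with [j] moved to the indicator list gives the factorisation on events
   of [X j]. Since [j] occurs in neither list, overriding its event by [A] disturbs no other
   factor. *)
- move=> A mA; pose B' i := if i == j then A else B i.
  have B'J i : i \in J2 -> B' i = B i.
    rewrite /B'; case: eqP => // -> iJ2.
    by move: j_notin; rewrite mem_cat iJ2 orbT.
  have B'j : B' j = A by rewrite /B' eqxx.
  have := IH (j :: J2) B'; rewrite !big_cons /=.
  rewrite -cat1s uniq_catCA cat1s /= j_notin uJ12 => /(_ isT).
  have -> : \prod_(i <- J2) P (X i @^-1` B' i) = \prod_(i <- J2) P (X i @^-1` B i).
    by apply: eq_big_seq => i iJ; rewrite B'J.
  rewrite B'j muleCA -/K muleC => <-.
    apply: eq_integral => w _; rewrite big_cons /G; congr EFin.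
    rewrite B'j -mulrA; congr (_ * _)%R; rewrite mulrC; congr (_ * _)%R.
    by apply: eq_big_seq => i iJ; rewrite B'J.
  by move=> i; rewrite /B'; case: ifP.
Qed.

Lemma integral_prod_indep (I : eqType) (X : I -> T -> R)
    (f : I -> R -> R) (J : seq I) :
  mutually_independent P X -> (forall i, measurable_fun setT (X i)) ->
  (forall i, measurable_fun setT (f i)) -> (forall i x, (0 <= f i x)%R) ->
  (forall i, \int[P]_w (f i (X i w))%:E < +oo) -> uniq J ->
  \int[P]_w (\prod_(j <- J) f j (X j w))%:E =
  \prod_(j <- J) \int[P]_w (f j (X j w))%:E.
Proof.
move=> indep mX mf f0 ffin uJ.
have := @integral_prod_indep_mixed I X f J [::] (fun=> setT) indep mX mf f0 ffin.
rewrite cats0 big_nil mule1 => <- //.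
by apply: eq_integral => w _; rewrite big_nil mulr1.
Qed.

End product_formula.

(** * Elementary inequalities for the exponential *)

Section exponential_bounds.
Context {R : realType}.

(** For [x >= - 2], square [1 + x / 2 <= expR (x / 2)]; for [x < - 2] the quartic term makes the
    left side negative. The error term is even, so no third moment enters when this is
    integrated. *)
Lemma quartic_le_expR (x : R) : 1 + x + x ^+ 2 / 4 - x ^+ 4 / 16 <= expR x.
Proof.
have x4 : x ^+ 4 = (x ^+ 2) ^+ 2 by ring.
have [x2|x2] := leP (- 2) x.
  have -> : expR x = expR (x / 2) ^+ 2.
    by rewrite -expRM_natl; congr expR; field.
  apply: (@le_trans _ _ ((1 + x / 2) ^+ 2)).
    have : 0 <= x ^+ 4 by rewrite x4 sqr_ge0.
    by rewrite sqrrD expr_div_n; lra.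
  by rewrite lerXn2r ?nnegrE ?expR_ge0 ?expR_ge1Dx//; lra.
apply: le_trans (expR_ge0 x); rewrite x4.
have : 4 <= x ^+ 2 by nra.
by nra.
Qed.

Lemma pow4_le_expR (y : R) : y ^+ 4 <= 256 * (expR y + expR (- y)).
Proof.
wlog y0 : y / 0 <= y.
  move=> H; have [|/ltW] := leP 0 y; first exact: H.
  rewrite -oppr_ge0 => /H; rewrite opprK addrC.
  by rewrite exprNn -signr_odd/= expr0 mul1r.
have -> : expR y = expR (y / 4) ^+ 4 by rewrite -expRM_natl; congr expR; field.
have : (y / 4) ^+ 4 <= expR (y / 4) ^+ 4.
  rewrite lerXn2r ?nnegrE ?expR_ge0//; first by rewrite divr_ge0.
  by apply: le_trans (expR_ge1Dx _); lra.
rewrite expr_div_n ler_pdivrMr; last by rewrite exprn_gt0.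
have -> : (4 : R) ^+ 4 = 256 by ring.
by have := expR_ge0 (- y); lra.
Qed.

Lemma expR_half_le2 : expR (1 / 2 : R) <= 2.
Proof.
have := expR_ge1Dx (- (1 / 2) : R); rewrite expRN => h.
have e0 := expR_gt0 (1 / 2 : R).
move: h; rewrite -(ler_pM2r e0) mulVf ?gt_eqF//. lra.
Qed.

(** Invert [1 - v / 2 <= expR (- (v / 2))] and use [(1 + v) * (1 - v / 2) >= 1] on the unit
    interval. *)
Lemma expR_half_le1D (v : R) : 0 <= v <= 1 -> expR (v / 2) <= 1 + v.
Proof.
move=> /andP[v0 v1]; have := expR_ge1Dx (- (v / 2)); rewrite expRN => h.
have e0 := expR_gt0 (v / 2).
move: h; rewrite -(ler_pM2r e0) mulVf ?gt_eqF// => h.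
rewrite -(ler_pM2l (_ : 0 < 1 - v / 2)); nra.
Qed.

End exponential_bounds.

(** * Lower bound for the moment generating function of a sub-Gaussian variable *)

Section moment_generating_function.
Context {d : measure_display} {T : measurableType d} {R : realType}.
Variable P : probability T R.
Local Open Scope ereal_scope.

Lemma ge0_integrable_lt_pinfty (f : T -> R) : measurable_fun setT f ->
  (forall w, (0 <= f w)%R) -> \int[P]_w (f w)%:E < +oo ->
  P.-integrable setT (EFin \o f).
Proof.
move=> mf f0 foo; apply/integrableP; split; first exact/measurable_EFinP.
by under eq_integral do rewrite /= ger0_norm//.
Qed.

(* The fourth moment is absorbed by the exponential moments at [+-1/s],
   through [y ^+ 4 <= 256 * (expR y + expR (- y))]. *)
Lemma mgf_ge (D : T -> R) (sigma s kappa lam : R) :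
  measurable_fun setT D -> P.-integrable setT (EFin \o D) ->
  \int[P]_w (D w)%:E = 0 -> \int[P]_w (D w ^+ 2)%:E = (sigma ^+ 2)%:E ->
  (0 < s)%R -> (s ^+ 2 <= kappa * sigma ^+ 2)%R ->
  (forall l, \int[P]_w (expR (l * D w))%:E <= (expR (l ^+ 2 * s ^+ 2 / 2))%:E) ->
  (1 <= kappa)%R -> (512 * kappa ^+ 2 * (lam * sigma) ^+ 2 <= 1)%R ->
  (expR (lam ^+ 2 * sigma ^+ 2 / 16))%:E <= \int[P]_w (expR (lam * D w))%:E.
Proof.
move=> mD iD D0 D2 s0 ssigma mgf_le kappa1 small.
have mexp l : measurable_fun setT (fun w => expR (l * D w)).
  by apply: measurableT_comp => //; apply: measurable_funM.
have iexp l : P.-integrable setT (fun w => (expR (l * D w))%:E).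
  apply: ge0_integrable_lt_pinfty => //.
  by rewrite (le_lt_trans (mgf_le l))// ltry.
have iD2 : P.-integrable setT (fun w => (D w ^+ 2)%:E).
  apply: ge0_integrable_lt_pinfty => //.
  - exact: measurable_funX.
  - by move=> w; exact: sqr_ge0.
  - by rewrite D2 ltry.
(* Here [16 = 256 / 16]: the 256 comes from [pow4_le_expR] at [D w / s], the 16 from the quartic
   term of [quartic_le_expR]. *)
pose c : R := (16 * (lam * s) ^+ 4)%R.
have c0 : (0 <= c)%R.
  by rewrite mulr_ge0// (_ : 4%N = (2 * 2)%N)// exprM sqr_ge0.
have iL : P.-integrable setT (fun w => 1 + (lam%:E * (D w)%:E + (lam ^+ 2 / 4)%:E * (D w ^+ 2)%:E)).
  apply: integrableD => //; first exact: finite_measure_integrable_cst.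
  by apply: integrableD => //; apply: integrableZl.
have iR : P.-integrable setT (fun w => (expR (lam * D w))%:E +
    c%:E * ((expR (s^-1 * D w))%:E + (expR (- s^-1 * D w))%:E)).
  by apply: integrableD => //; apply: integrableZl => //; apply: integrableD.
have : \int[P]_w (1 + (lam%:E * (D w)%:E + (lam ^+ 2 / 4)%:E * (D w ^+ 2)%:E)) <=
    \int[P]_w ((expR (lam * D w))%:E +
    c%:E * ((expR (s^-1 * D w))%:E + (expR (- s^-1 * D w))%:E)).
  apply: le_integral => // w _; rewrite -!EFinM -!EFinD lee_fin.
  have := quartic_le_expR (lam * D w).
  have := pow4_le_expR (s^-1 * D w).
  rewrite mulNr; set e1 := expR _; set e2 := expR _; set e3 := expR _ => h1 h2.
  have -> : (c * (e1 + e2) = (lam * s) ^+ 4 / 16 * (256 * (e1 + e2)))%R.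
    by rewrite /c; field.
  have : ((lam * s) ^+ 4 / 16 * (s^-1 * D w) ^+ 4 <=
          (lam * s) ^+ 4 / 16 * (256 * (e1 + e2)))%R.
    by apply: ler_wpM2l => //; move: c0; rewrite /c; lra.
  have -> : ((lam * s) ^+ 4 / 16 * (s^-1 * D w) ^+ 4 = (lam * D w) ^+ 4 / 16)%R.
    by field; rewrite gt_eqF.
  by lra.
rewrite integralD//; last 2 first.
- exact: finite_measure_integrable_cst.
- by apply: integrableD => //; apply: integrableZl.
rewrite integralD//; [|exact: integrableZl|exact: integrableZl].
rewrite !integralZl// D0 D2 mule0 add0e integral_cst//.
rewrite [X in _ * X + _]probability_setT mule1.
rewrite integralD//; last by apply: integrableZl => //; apply: integrableD.
rewrite integralZl//; last exact: integrableD.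
rewrite integralD// => main.
have e2 l : (l ^+ 2 = s ^- 2)%R -> \int[P]_w (expR (l * D w))%:E <= 2%:E.
  move=> l2; rewrite (le_trans (mgf_le l))// lee_fin.
  by rewrite l2 mulVf ?gt_eqF ?exprn_gt0// expR_half_le2.
have Ele : c%:E * (\int[P]_w (expR (s^-1 * D w))%:E +
    \int[P]_w (expR (- s^-1 * D w))%:E) <= (4 * c)%:E.
  have -> : (4 * c)%:E = c%:E * (2%:E + 2%:E).
    by rewrite -EFinD -EFinM; congr EFin; ring.
  apply: lee_wpmul2l; first by rewrite lee_fin.
  by apply: leeD; apply: e2; rewrite ?sqrrN exprVn.
have {}main := le_trans main (leeD2l _ Ele).
move: main; rewrite -leeBlDr// -EFinM -EFinD; apply: le_trans.
rewrite lee_fin.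
set q := (lam ^+ 2 * sigma ^+ 2)%R.
have q0 : (0 <= q)%R by rewrite mulr_ge0// sqr_ge0.
have qsmall : (512 * kappa ^+ 2 * q <= 1)%R by rewrite /q -exprMn.
have k2 : (1 <= kappa ^+ 2)%R by rewrite exprn_ege1.
have q1 : (q <= 1)%R by nra.
(* [4 * c = 64 * (lam * s) ^+ 4] is at most [64 * kappa ^+ 2 * q ^+ 2], and the smallness hypothesis
   with its constant [512 = 8 * 64] turns this into [q / 8]. What remains of [1 + q / 4] is
   [1 + q / 8], which dominates [expR (q / 16)]. *)
have cq : (4 * c <= q / 8)%R.
  rewrite /c; have -> : ((lam * s) ^+ 4 = (lam ^+ 2 * s ^+ 2) ^+ 2)%R by ring.
  have : (lam ^+ 2 * s ^+ 2 <= kappa * q)%R.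
    by rewrite /q [leRHS]mulrCA; apply: ler_wpM2l => //; exact: sqr_ge0.
  have : (0 <= lam ^+ 2 * s ^+ 2)%R by rewrite mulr_ge0// sqr_ge0.
  set z := (lam ^+ 2 * s ^+ 2)%R => z0 zq.
  have : (z ^+ 2 <= (kappa * q) ^+ 2)%R.
    by rewrite lerXn2r ?nnegrE// (le_trans z0).
  by rewrite exprMn; nra.
have := @expR_half_le1D R (q / 8) ltac:(lra).
have -> : (q / 8 / 2 = q / 16)%R by field.
have -> : (lam ^+ 2 / 4 * sigma ^+ 2 = q / 4)%R by rewrite /q; ring.
by move=> h; rewrite (le_trans h)//; lra.
Qed.

End moment_generating_function.

(** * Lower tail of a sum of independent variables *)

Section lower_tail.
Context {d : measure_display} {T : measurableType d} {R : realType}.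
Variable P : probability T R.
Local Open Scope ereal_scope.

(* Paley-Zygmund; Cauchy-Schwarz is replaced by the pointwise bound
   [V <= th + V ^+ 2 / (4 * Q) + Q * \1_[set w | th <= V w]]. *)
Lemma paley_zygmund (V : T -> R) (th Q : R) :
  measurable_fun setT V -> (forall w, (0 <= V w)%R) -> (0 < Q)%R ->
  \int[P]_w (V w ^+ 2)%:E <= Q%:E -> (0 <= th)%R ->
  (2 * th)%:E <= \int[P]_w (V w)%:E -> 1 <= \int[P]_w (V w)%:E ->
  ((4 * Q)^-1)%:E <= P [set w | (th <= V w)%R].
Proof.
move=> mV V0 Q0 VQ th0 thM M1.
set A := [set w | _].
have mA : measurable A.
  rewrite /A (_ : mkset _ = V @^-1` `[th, +oo[); last first.
    by apply/seteqP; split => w /=; rewrite in_itv/= andbT.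
  by rewrite -[_ @^-1` _]setTI; exact: mV.
have Q4 : (0 <= (4 * Q)^-1)%R by rewrite invr_ge0 mulr_ge0// ltW.
have mV2 : measurable_fun setT (fun w => (V w ^+ 2)%:E).
  by apply/measurable_EFinP; apply: measurable_funX.
have m1A : measurable_fun setT (fun w => (\1_A w)%:E : \bar R).
  by apply/measurable_EFinP; exact: measurable_indic.
have key : \int[P]_w (V w)%:E <=
    \int[P]_w (th%:E + ((4 * Q)^-1%:E * (V w ^+ 2)%:E + Q%:E * (\1_A w)%:E)).
  apply: ge0_le_integral => //.
  - by move=> w _; rewrite lee_fin.
  - exact/measurable_EFinP.
  - by apply: emeasurable_funD => //; apply: emeasurable_funD;
      apply: emeasurable_funM.
  - move=> w _; rewrite -!EFinM -!EFinD lee_fin indicE.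
    have V20 : (0 <= (4 * Q)^-1 * V w ^+ 2)%R by rewrite mulr_ge0// sqr_ge0.
    case: (boolP (w \in A)) => [_|]; rewrite /= ?mulr1n ?mulr0n ?mulr1 ?mulr0; last first.
      by rewrite notin_setE /A /= => /negP; rewrite -ltNge => /ltW; lra.
    rewrite -subr_ge0; apply: (@le_trans _ _ ((4 * Q)^-1 * (V w - 2 * Q) ^+ 2)%R).
      by rewrite mulr_ge0// sqr_ge0.
    rewrite (_ : (4 * Q)^-1 * (V w - 2 * Q) ^+ 2 =
      (4 * Q)^-1 * V w ^+ 2 + Q - V w)%R; first by lra.
    by field; rewrite gt_eqF.
move: key; rewrite ge0_integralD//; last 2 first.
- by move=> w _; rewrite adde_ge0// lee_fin mulr_ge0 ?sqr_ge0// ltW.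
- by apply: emeasurable_funD; apply: emeasurable_funM.
rewrite ge0_integralD//; first last.
- by apply: emeasurable_funM.
- by move=> w _; rewrite lee_fin mulr_ge0// ltW.
- by apply: emeasurable_funM.
- by move=> w _; rewrite lee_fin mulr_ge0// sqr_ge0.
rewrite !ge0_integralZl_EFin// ?(ltW Q0)//; last first.
  by move=> w _; rewrite lee_fin sqr_ge0.
rewrite integral_cst// [X in _ * X + _]probability_setT mule1.
rewrite integral_indic// setIT.
have PA : P A = (fine (P A))%:E by rewrite fineK//; exact: fin_num_measure.
rewrite [X in Q%:E * X]PA => h2; rewrite PA; move: h2; set p := fine (P A).
have : (4 * Q)^-1%:E * \int[P]_w (V w ^+ 2)%:E <= (4^-1)%:E.
  apply: le_trans (lee_wpmul2l _ VQ) _; first by rewrite lee_fin.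
  by rewrite -EFinM lee_fin invfM -mulrA mulVf ?mulr1// gt_eqF.
(* Since [th] is at most half the mean and the mean is at least 1, the bound mean
   [<= th + 1/4 + Q * p] leaves [Q * p >= 1/4]. *)
move=> h1 h2.
have {h1 h2} : \int[P]_w (V w)%:E <= (th + (4^-1 + Q * p))%:E.
  apply: le_trans h2 _; rewrite EFinD; apply: leeD => //.
  by rewrite EFinD EFinM; apply: leeD.
move: thM M1; case: (integral _ _ _) => [M| |]//.
rewrite !lee_fin => thM M1 MQ.
by rewrite -(ler_pM2l Q0) invfM mulrCA mulfV ?gt_eqF// mulr1; lra.
Qed.

Lemma prode_ge_expn (I : eqType) (J : seq I) (g : I -> \bar R) (c : R) :
  (0 <= c)%R -> (forall j, c%:E <= g j) ->
  (c ^+ size J)%:E <= \prod_(j <- J) g j.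
Proof.
move=> c0 cg; elim: J => [|j J IH]; first by rewrite big_nil.
rewrite big_cons /= exprS EFinM lee_pmul// ?lee_fin ?exprn_ge0//.
Qed.

Lemma prode_le_expn (I : eqType) (J : seq I) (g : I -> \bar R) (c : R) :
  (forall j, 0 <= g j) -> (forall j, g j <= c%:E) ->
  \prod_(j <- J) g j <= (c ^+ size J)%:E.
Proof.
move=> g0 gc; elim: J => [|j J IH]; first by rewrite big_nil.
by rewrite big_cons /= exprS EFinM lee_pmul//; apply: prode_ge0.
Qed.

(** The event is [V >= expR (lam * (x + size J * mu))] for the product [V] of the exponentials, so
    [paley_zygmund] applies. By independence the moments of [V] factor: [M] bounds the logarithm of
    the first moment per variable from below, [Q] that of the second from above. The last hypothesis
    puts the threshold below half the mean of [V]. *)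
Lemma indep_sum_lower_tail (I : eqType) (X : I -> T -> R) (J : seq I)
    (mu lam x M Q : R) :
  mutually_independent P X -> (forall i, measurable_fun setT (X i)) -> uniq J ->
  (0 < lam)%R ->
  (forall i, (expR M)%:E <= \int[P]_w (expR (- lam * (X i w - mu)))%:E) ->
  (forall i, \int[P]_w (expR (- lam * (X i w - mu)))%:E < +oo) ->
  (forall i, \int[P]_w (expR (- (2 * lam) * (X i w - mu)))%:E <= (expR Q)%:E) ->
  (0 <= M)%R ->
  (2 * expR (lam * (x + (size J)%:R * mu)) <= expR ((size J)%:R * M))%R ->
  (4^-1 * expR (- ((size J)%:R * Q)))%:E <= P [set w | \sum_(j <- J) X j w <= - x]%R.
Proof.
move=> indep mX uJ lam0 Mlow fin Qup M0 hx.
have mexp l : measurable_fun setT (fun y : R => expR (l * (y - mu))).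
  by apply: measurableT_comp => //; apply: measurable_funM => //;
    apply: measurable_funB.
pose V w := (\prod_(j <- J) expR (- lam * (X j w - mu)))%R.
have VE w : V w = expR (- lam * (\sum_(j <- J) X j w - (size J)%:R * mu)).
  rewrite /V; elim: (J) => [|j J' IH].
    by rewrite !big_nil mul0r subrr mulr0 expR0.
  rewrite !big_cons IH -expRD; congr expR => /=.
  by rewrite -natr1; ring.
have mV : measurable_fun setT V.
  by apply: measurable_prod => j _; apply: (measurableT_comp (mexp _)).
have EV : \int[P]_w (V w)%:E =
    \prod_(j <- J) \int[P]_w (expR (- lam * (X j w - mu)))%:E.
  by apply: (@integral_prod_indep _ _ _ P I X (fun _ y => expR (- lam * (y - mu)))) => //
    i y; rewrite expR_ge0.
have EV2 : \int[P]_w (V w ^+ 2)%:E =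
    \prod_(j <- J) \int[P]_w (expR (- (2 * lam) * (X j w - mu)))%:E.
  rewrite -(@integral_prod_indep _ _ _ P I X (fun _ y => expR (- (2 * lam) * (y - mu))))//.
    - apply: eq_integral => w _; rewrite /V -prodrXl; congr EFin.
      by apply: eq_bigr => j _; rewrite -expRM_natl; congr expR; ring.
    - by move=> i; rewrite (le_lt_trans (Qup i))// ltry.
have EVlow : (expR ((size J)%:R * M))%:E <= \int[P]_w (V w)%:E.
  by rewrite EV expRM_natl; apply: prode_ge_expn => //; exact: expR_ge0.
have := @paley_zygmund V (expR (lam * (x + (size J)%:R * mu)))
  (expR ((size J)%:R * Q)) mV _ (expR_gt0 _) _ (expR_ge0 _) _ _.
rewrite invfM expRN.
rewrite (_ : [set w | _] = [set w | \sum_(j <- J) X j w <= - x]%R); last first.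
  apply/seteqP; split => w /=; rewrite VE ler_expR -subr_ge0 => h.
  - by rewrite -(ler_pM2l lam0); lra.
  - by move: h; rewrite subr_ge0 -(ler_pM2l lam0); lra.
apply.
- by move=> w; apply: prodr_ge0 => j _; exact: expR_ge0.
- rewrite EV2 expRM_natl; apply: prode_le_expn => // j.
  by apply: integral_ge0 => w _; rewrite lee_fin expR_ge0.
- by apply: le_trans EVlow; rewrite lee_fin.
- apply: le_trans EVlow; rewrite lee_fin -expR0 ler_expR.
  by rewrite mulr_ge0.
Qed.

Lemma same_distribution_integral (X Y : T -> R) (f : R -> R) :
  measurable_fun setT X -> measurable_fun setT Y -> same_distribution P X Y ->
  measurable_fun setT f -> (forall x, (0 <= f x)%R) ->
  \int[P]_w (f (X w))%:E = \int[P]_w (f (Y w))%:E.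
Proof.
move=> mX mY XY mf f0.
have mEf : measurable_fun setT (EFin \o f) by exact/measurable_EFinP.
have E (U : T -> R) : measurable_fun setT U ->
    \int[pushforward P U]_y (f y)%:E = \int[P]_w (f (U w))%:E.
  by move=> mU; rewrite ge0_integral_pushforward// => y _; rewrite /= lee_fin.
rewrite -!E//; apply: eq_measure_integral => A mA _; exact: XY.
Qed.

End lower_tail.

(** * Energy balance across a block of nodes *)

Definition overflow {R : realType} (C g : R) : R := pospart (g - C) + pospart (- C - g).

Section block_cut.
Context {R : realType}.

Lemma negpart_ge0 (x : R) : 0 <= negpart x.
Proof. by rewrite /negpart le_max lexx orbT. Qed.

Lemma overflow_ge0 (C g : R) : 0 <= overflow C g.
Proof. by rewrite addr_ge0// le_max lexx orbT. Qed.

Lemma overflow_ge (C g : R) : g - C <= overflow C g.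
Proof.
by rewrite -[leLHS]addr0 lerD// /pospart le_max lexx ?orbT.
Qed.

(** This symmetry makes the orientation of the edges immaterial. *)
Lemma overflowN (C g : R) : overflow C (- g) = overflow C g.
Proof. by rewrite /overflow opprK addrC [- C + g]addrC [- g - C]addrC. Qed.

(* Net generation of a block can only leave through its two boundary edges,
   or through fast generation inside the block. *)
Lemma block_shortfall (W Z g : nat -> R) (C : R) (a m : nat) :
  (forall i, W i.+1 = Z i.+1 - g i.+1 + g i) ->
  - (\sum_(a <= i < a + m) Z i.+1) - 2 * C <=
  \sum_(a <= i < a + m) negpart (W i.+1) + overflow C (g a) + overflow C (g (a + m)%N).
Proof.
move=> WE.
have sumW : \sum_(a <= i < a + m) W i.+1 =
    \sum_(a <= i < a + m) Z i.+1 - g (a + m)%N + g a.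
  rewrite -addrA; under eq_bigr do rewrite WE -addrA.
  rewrite big_split /=; congr (_ + _).
  rewrite -(opprK (\sum_(_ <= _ < _) _)) -sumrN.
  rewrite (eq_bigr (fun i => g i.+1 - g i)); last by move=> i _; rewrite opprD opprK.
  by rewrite telescope_sumr ?leq_addr// opprB addrC.
have : - \sum_(a <= i < a + m) W i.+1 <= \sum_(a <= i < a + m) negpart (W i.+1).
  by rewrite -sumrN; apply: ler_sum => i _; rewrite /negpart le_max lexx.
have := overflow_ge C (g a); have := overflow_ge C (- g (a + m)%N).
by rewrite overflowN sumW; lra.
Qed.

End block_cut.

(** * Summing over disjoint blocks *)

Section averaging.
Context {R : realType}.
Local Open Scope ereal_scope.

(** Consecutive blocks share a boundary edge, so each edge is counted twice on the right. The extra
    [e (k * m)] on the left carries the second copy of the last edge through the induction, to serve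
    as left boundary of the next block. *)
Lemma sum_disjoint_blocks (w e : nat -> \bar R) (b : R) (m k : nat) :
  (0 < m)%N -> (forall i, 0 <= w i) -> (forall i, 0 <= e i) ->
  (forall a, b%:E <= \sum_(a <= i < a + m) w i.+1 + e a + e (a + m)%N) ->
  (k%:R * b)%:E + e (k * m)%N <=
  \sum_(0 <= i < (k * m).+1) (w i + (e i + e i)).
Proof.
move=> m0 w0 e0 blk.
elim: k => [|k IH].
  rewrite mul0r add0e mul0n big_nat1 -[leLHS]add0e leeD//.
  by rewrite -[leLHS]add0e leeD.
have last_edge : e (k * m + m)%N + e (k * m + m)%N <=
    \sum_(k * m <= i < k * m + m) (e i.+1 + e i.+1).
  rewrite -(prednK m0) addnS big_nat_recr ?leq_addr//= -[leLHS]add0e leeD//.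
  by apply: sume_ge0 => i _; rewrite adde_ge0.
rewrite mulSnr (@big_cat_nat _ _ _ (k * m).+1)//= ?ltnS ?leq_addr// big_add1/=.
rewrite [X in _ <= _ + X]big_split/= -natr1 mulrDl mul1r EFinD.
apply: le_trans _ (leeD IH (leeD (lexx _) last_edge)).
apply: (@le_trans _ _ ((k%:R * b)%:E +
  (\sum_(k * m <= i < k * m + m) w i.+1 + e (k * m)%N + e (k * m + m)%N) +
  e (k * m + m)%N)).
  by rewrite leeD2r// leeD2l.
by rewrite le_eqVlt; apply/orP; left; apply/eqP; rewrite !addeA;
  congr (_ + _ + _); rewrite -!addeA; congr (_ + _); rewrite addeC.
Qed.

Lemma limn_einf_ge (u : (\bar R)^nat) (c : \bar R) (N : nat) :
  (forall n, (N <= n)%N -> c <= u n) -> c <= limn_einf u.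
Proof.
move=> cu; rewrite limn_einf_lim; apply: lime_ge; first exact: is_cvg_einfs.
exists N => // n /= Nn; apply: le_ereal_inf_tmp => _ [k /= nk <-].
by apply: cu; rewrite (leq_trans Nn).
Qed.

End averaging.

(** * From the probability of a block deficit to a bound on [eps_tot] *)

Section shortage.
Context {d : measure_display} {T : measurableType d} {R : realType}.
Variable P : probability T R.

Lemma measurable_negpart (X : T -> R) : measurable_fun setT X ->
  measurable_fun setT (fun w => negpart (X w)).
Proof. by move=> mX; apply: measurable_maxr => //; exact: measurableT_comp. Qed.

Lemma measurable_overflow (C : R) (X : T -> R) : measurable_fun setT X ->
  measurable_fun setT (fun w => overflow C (X w)).
Proof.
move=> mX; apply: measurable_funD; apply: measurable_maxr => //;
  exact: measurable_funB.
Qed.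

(** Of a deficit [3 * C], the two boundary edges can supply [2 * C] within capacity; the remaining
    [C] is paid as backup or overflow. Integrating over the deficit event gives [C * p]. *)
Lemma expected_block_shortfall (C : R) (W Z g : nat -> T -> R) (a m : nat) (p : R) :
  0 < C -> (forall i, measurable_fun setT (W i)) ->
  (forall i, measurable_fun setT (Z i)) -> (forall i, measurable_fun setT (g i)) ->
  (forall i w, W i.+1 w = Z i.+1 w - g i.+1 w + g i w) ->
  (p%:E <= P [set w | (\sum_(a <= i < a + m) Z i.+1 w <= - (3 * C))%R])%E ->
  ((C * p)%:E <= \sum_(a <= i < a + m) 'E_P[fun w => negpart (W i.+1 w)] +
     'E_P[fun w => overflow C (g a w)] + 'E_P[fun w => overflow C (g (a + m)%N w)])%E.
Proof.
move=> C0 mW mZ mg WE pA; rewrite expectation.unlock.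
set A := [set w | _] in pA.
have mS : measurable_fun setT (fun w => \sum_(a <= i < a + m) Z i.+1 w).
  by apply: measurable_sum => i.
have mA : measurable A.
  rewrite /A (_ : mkset _ = (fun w => \sum_(a <= i < a + m) Z i.+1 w) @^-1` `]-oo, (- (3 * C))]).
    by rewrite -[_ @^-1` _]setTI; exact: mS.
  by apply/seteqP; split => w /=; rewrite in_itv.
have mN i : measurable_fun setT (fun w => (negpart (W i.+1 w))%:E).
  by apply/measurable_EFinP; exact: measurable_negpart.
have mO i : measurable_fun setT (fun w => (overflow C (g i w))%:E).
  by apply/measurable_EFinP; exact: measurable_overflow.
apply: (@le_trans _ _ (\int[P]_w (C%:E * (\1_A w)%:E))%E).
  rewrite ge0_integralZl_EFin ?(ltW C0)//; last first.
    by apply/measurable_EFinP; exact: measurable_indic.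
  by rewrite integral_indic// setIT EFinM; apply: lee_wpmul2l; rewrite ?lee_fin// ltW.
rewrite -ge0_integral_sum//; last by move=> i w _; rewrite lee_fin negpart_ge0.
rewrite -ge0_integralD//; first last.
- by move=> w _; rewrite lee_fin overflow_ge0.
- by apply: emeasurable_sum.
- by move=> w _; apply: sume_ge0 => i _; rewrite lee_fin negpart_ge0.
rewrite -ge0_integralD//; first last.
- by move=> w _; rewrite lee_fin overflow_ge0.
- by apply: emeasurable_funD => //; apply: emeasurable_sum.
- move=> w _; rewrite adde_ge0 ?lee_fin ?overflow_ge0//.
  by apply: sume_ge0 => i _; rewrite lee_fin negpart_ge0.
apply: ge0_le_integral => //.
- by move=> w _; rewrite -EFinM lee_fin mulr_ge0// ltW.
- by apply: emeasurable_funM => //; apply/measurable_EFinP; exact: measurable_indic.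
- by do 2 apply: emeasurable_funD => //; apply: emeasurable_sum.
move=> w _; rewrite sumEFin -!EFinD -EFinM lee_fin.
have := @block_shortfall R (W ^~ w) (Z ^~ w) (g ^~ w) C a m (WE ^~ w).
rewrite indicE; case: (boolP (w \in A)) => [|_ _]; rewrite /= ?mulr1n ?mulr0n ?mulr1 ?mulr0.
  by rewrite inE /A /=; lra.
do 2 rewrite addr_ge0 ?overflow_ge0//.
by apply: sumr_ge0 => i _; exact: negpart_ge0.
Qed.

(** One factor 2 in the constant 4 pays for the doubled edges, the other for the nodes outside
    complete blocks. The edge normalisation [n * n.-1] only helps, being at most [n * n]. *)
Lemma eps_tot_ge (C b : R) (W F : int -> nat -> T -> R) (m n : nat) :
  (0 < m)%N -> 0 <= b ->
  (forall t k, ((k%:R * b)%:E <= \sum_(0 <= i < (k * m).+1)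
    ('E_P[fun w => negpart (W i%:Z t w)] +
     ('E_P[fun w => overflow C (F i%:Z t w)] +
      'E_P[fun w => overflow C (F i%:Z t w)])))%E) ->
  (2 * m + 2 <= n)%N -> ((b / (4 * m%:R))%:E <= eps_tot P C W F n)%E.
Proof.
move=> m0 b0 blk mn.
have n0 : (0 < n)%N by lia.
have n1 : (0 < n.-1)%N by lia.
(* Index [k * m] must also be an edge of the box, whose last edge is [n - 2]. The hypothesis
   [2 * m + 2 <= n] ensures that the blocks cover at least half of it. *)
pose k := ((n - 2) %/ m)%N.
have km : (k * m <= n - 2)%N by exact: leq_divM.
have kn : (n <= 2 * (k * m))%N.
  by have := ltn_ceil (n - 2) m0; rewrite -/k; lia.
pose u t (i : nat) := ('E_P[fun w => negpart (W i%:Z t w)])%E.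
pose v t (i : nat) := ('E_P[fun w => overflow C (F i%:Z t w)])%E.
have u0 t i : (0 <= u t i)%E by apply: expectation_ge0 => w; exact: negpart_ge0.
have v0 t i : (0 <= v t i)%E by apply: expectation_ge0 => w; exact: overflow_ge0.
have half t : ((k%:R * b / 2)%:E <= \sum_(i < n) u t i + \sum_(i < n.-1) v t i)%E.
  have := blk t k; rewrite big_split/= big_split/=.
  have leU : (\sum_(0 <= i < (k * m).+1) u t i <= \sum_(i < n) u t i)%E.
    rewrite -(big_mkord xpredT (u t)) (@big_cat_nat _ _ _ (k * m).+1 0 n)//=; last by lia.
    by rewrite leeDl// sume_ge0.
  have leV : (\sum_(0 <= i < (k * m).+1) v t i <= \sum_(i < n.-1) v t i)%E.
    rewrite -(big_mkord xpredT (v t)) (@big_cat_nat _ _ _ (k * m).+1 0 n.-1)//=; last by lia.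
    by rewrite leeDl// sume_ge0.
  move=> h; have {h leU leV} := le_trans h (leeD leU (leeD leV leV)).
  have : (0 <= \sum_(i < n) u t i)%E by rewrite sume_ge0.
  have : (0 <= \sum_(i < n.-1) v t i)%E by rewrite sume_ge0.
  move: (\sum_(i < n) u t i)%E (\sum_(i < n.-1) v t i)%E => [U| |] [V| |]//=; rewrite ?addye// ?addey// ?leey//.
  by rewrite -!EFinD !lee_fin; lra.
have sum_half : ((n%:R * (k%:R * b / 2))%:E <=
    \sum_(t < n) \sum_(i < n) u t i + \sum_(t < n) \sum_(i < n.-1) v t i)%E.
  rewrite -big_split/=.
  have -> : (n%:R * (k%:R * b / 2))%:E = (\sum_(t < n) (k%:R * b / 2)%:E)%E.
    by rewrite sumEFin big_const_ord iter_addr_0 mulr_natl.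
  by apply: lee_sum => t _; exact: half.
have n0R : 0 < n%:R :> R by rewrite ltr0n.
have n1R : 0 < n.-1%:R :> R by rewrite ltr0n.
have m0R : 0 < m%:R :> R by rewrite ltr0n.
rewrite /eps_tot -[X in (_ * X + _)%E]/(\sum_(t < n) \sum_(i < n) u t i)%E.
rewrite -[X in (_ + _ * X)%E]/(\sum_(t < n) \sum_(i < n.-1) v t i)%E.
apply: (@le_trans _ _ ((n%:R * n%:R)^-1%:E * (\sum_(t < n) \sum_(i < n) u t i +
    \sum_(t < n) \sum_(i < n.-1) v t i))%E).
  apply: le_trans (lee_wpmul2l _ sum_half); last first.
    by rewrite lee_fin invr_ge0 mulr_ge0.
  rewrite -EFinM lee_fin ler_pdivrMr ?mulr_gt0//.
  have -> : (n%:R * n%:R)^-1 * (n%:R * (k%:R * b / 2)) * (4 * m%:R) =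
     b * (2 * (k%:R * m%:R) / n%:R) :> R by field; rewrite gt_eqF.
  rewrite ler_peMr// ler_pdivlMr// mul1r.
  by rewrite -!natrM ler_nat.
rewrite ge0_muleDr; try by apply: sume_ge0 => t _; apply: sume_ge0.
apply: leeD => //; apply: lee_wpmul2r; first by apply: sume_ge0 => t _; apply: sume_ge0.
by rewrite lee_fin lef_pV2 ?posrE ?mulr_gt0// ler_pM2l// ler_nat leq_pred.
Qed.

End shortage.

(** * The i.i.d. grid: deficit probability and the bound at scale [nu] *)

Section iid_grid.
Context {d : measure_display} {T : measurableType d} {R : realType}.
Variable P : probability T R.
Variables (kappa mu sigma : R) (Z : int -> nat -> T -> R).
Hypothesis mZ : forall i t, measurable_fun setT (Z i t).
Hypothesis indepZ : mutually_independent P (fun it : int * nat => Z it.1 it.2).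
Hypothesis sameZ : forall i t, same_distribution P (Z i t) (Z 0%Z 0%N).
Hypothesis inS : in_S P kappa (Z 0%Z 0%N).
Hypothesis EZ : ('E_P[Z 0%Z 0%N] = mu%:E)%E.
Hypothesis VZ : ('V_P[Z 0%Z 0%N] = (sigma ^+ 2)%:E)%E.
Hypotheses (kappa1 : 1 <= kappa) (sigma0 : 0 < sigma).

Lemma in_S_mgf_bounds : exists s2 : R, [/\ 0 < s2, s2 <= kappa * sigma ^+ 2,
  forall l, (\int[P]_w (expR (l * (Z 0%Z 0%N w - mu)))%:E <=
             (expR (l ^+ 2 * s2 / 2))%:E)%E &
  forall l, 512 * kappa ^+ 2 * (l * sigma) ^+ 2 <= 1 ->
    ((expR (l ^+ 2 * sigma ^+ 2 / 16))%:E <=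
     \int[P]_w (expR (l * (Z 0%Z 0%N w - mu)))%:E)%E].
Proof.
case: inS => sigma2 [s2 [VZ' [sigma20 [[iZ mgf] [ge1 ltk]]]]].
have s2E : sigma2 = sigma ^+ 2 by move: VZ'; rewrite VZ => -[].
rewrite s2E in sigma20 ge1 ltk.
have s20 : 0 < s2.
  by move: ge1; rewrite ler_pdivlMr// mul1r; exact: lt_le_trans.
have s2k : s2 <= kappa * sigma ^+ 2 by move: ltk; rewrite ltr_pdivrMr// => /ltW.
have {}mgf l : (\int[P]_w (expR (l * (Z 0%Z 0%N w - mu)))%:E <=
    (expR (l ^+ 2 * s2 / 2))%:E)%E.
  by have := mgf l; rewrite EZ expectation.unlock.
exists s2; split => // l small.
have mD : measurable_fun setT (fun w => Z 0%Z 0%N w - mu) by exact: measurable_funB.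
have sq : Num.sqrt s2 ^+ 2 = s2 by rewrite sqr_sqrtr// ltW.
apply: (@mgf_ge _ _ _ P _ sigma (Num.sqrt s2) kappa); rewrite ?sq ?sqrtr_gt0//.
- rewrite (_ : EFin \o _ = ((EFin \o Z 0%Z 0%N) \- (EFin \o cst mu))%E)//.
  by apply: integrableB => //; exact: finite_measure_integrable_cst.
- under eq_integral do rewrite EFinB.
  rewrite integralB_EFin//; last exact: finite_measure_integrable_cst.
  rewrite integral_cst// [X in (_ * X)%E]probability_setT mule1.
  by move: EZ; rewrite expectation.unlock => ->; rewrite subee.
- by rewrite -VZ /variance covariance.unlock EZ expectation.unlock.
Qed.

Lemma block_lower_tail (C nu : R) (m a t : nat) :
  0 < nu -> mu <= nu -> sigma ^+ 2 <= nu * C -> 32 * kappa * (100 * nu) <= sigma ->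
  C <= m%:R * nu -> m%:R * nu <= 2 * C ->
  ((4^-1 * expR (- (200 ^+ 2 * kappa * nu * C / sigma ^+ 2)))%:E <=
   P [set w | (\sum_(a <= i < a + m) Z i.+1%:Z t w <= - (3 * C))%R])%E.
Proof.
move=> nu0 munu nuC nusigma mC m2C.
have [s2 [s20 s2k mgf_up mgf_low]] := in_S_mgf_bounds.
have kappa_ge0 : 0 <= kappa by apply: le_trans kappa1.
have sig2 : 0 < sigma ^+ 2 by rewrite exprn_gt0.
have [lam lam0 lamS] : exists2 lam, 0 < lam & lam * sigma ^+ 2 = 100 * nu.
  exists (100 * nu / sigma ^+ 2); first by rewrite divr_gt0 ?mulr_gt0 ?ltr0n.
  by field; rewrite gt_eqF.
have small : 512 * kappa ^+ 2 * (lam * sigma) ^+ 2 <= 1.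
  have kn : 0 <= 32 * kappa * (100 * nu).
    by rewrite mulr_ge0 ?mulr_ge0 ?(ltW nu0) ?kappa_ge0 ?ler0n.
  have : (32 * kappa * (100 * nu)) ^+ 2 <= sigma ^+ 2.
    by rewrite lerXn2r// nnegrE; lra.
  move=> h; rewrite -(ler_pM2r sig2) mul1r.
  have -> : 512 * kappa ^+ 2 * (lam * sigma) ^+ 2 * sigma ^+ 2 =
     2^-1 * (32 * kappa * (100 * nu)) ^+ 2.
    have e : (lam * sigma) ^+ 2 * sigma ^+ 2 = (100 * nu) ^+ 2 by rewrite -lamS; ring.
    by rewrite -[LHS]mulrA e; set y := 100 * nu; field.
  by move: h; set y := _ ^+ 2; lra.
pose J := [seq (i.+1%:Z, t) | i <- index_iota a (a + m)].
have sizeJ : size J = m by rewrite size_map size_iota addKn.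
have iid l (it : int * nat) : (\int[P]_w (expR (l * (Z it.1 it.2 w - mu)))%:E =
    \int[P]_w (expR (l * (Z 0%Z 0%N w - mu)))%:E)%E.
  apply: (@same_distribution_integral _ _ _ P _ _ (fun y => expR (l * (y - mu)))) => //.
  by apply: measurableT_comp => //; apply: measurable_funM => //;
      apply: measurable_funB.
have main : ((4^-1 * expR (- (m%:R * ((2 * lam) ^+ 2 * s2 / 2))))%:E <=
     P [set w | (\sum_(j <- J) Z j.1 j.2 w <= - (3 * C))%R])%E.
  rewrite -sizeJ; apply: (@indep_sum_lower_tail _ _ _ P _ _ J mu lam (3 * C)
    (lam ^+ 2 * sigma ^+ 2 / 16)) => //.
  - by rewrite map_inj_uniq ?iota_uniq// => i j [].
  - by move=> it; rewrite iid; have := mgf_low (- lam); rewrite mulNr !sqrrN; exact.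
  - by move=> it; rewrite iid (le_lt_trans (mgf_up _))// ltry.
  - by move=> it; rewrite iid; have := mgf_up (- (2 * lam)); rewrite sqrrN.
  - by rewrite divr_ge0// mulr_ge0// sqr_ge0.
  - rewrite sizeJ; have two : 2 <= expR 1 :> R by have := expR_ge1Dx (1 : R); lra.
    apply: (@le_trans _ _ (expR 1 * expR (lam * (3 * C + m%:R * mu)))).
      by rewrite ler_wpM2r// expR_ge0.
    rewrite -expRD ler_expR.
    (* This is at least [6.25 * lam * C]. The other side is at most [1 + 5 * lam * C], because
       [m * mu <= m * nu <= 2 * C], and [1 <= lam * C / 100]. *)
    have -> : m%:R * (lam ^+ 2 * sigma ^+ 2 / 16) = lam * (100 * (m%:R * nu) / 16).
      by rewrite expr2 -[lam * lam * _]mulrA lamS; ring.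
    have lamC : 100 <= lam * C.
      by rewrite -(ler_pM2r sig2) mulrAC lamS -mulrA ler_pM2l.
    have : lam * (m%:R * mu) <= lam * (2 * C).
      by rewrite ler_pM2l// (le_trans _ m2C)// ler_wpM2l.
    have : lam * C <= lam * (m%:R * nu) by rewrite ler_pM2l.
    by lra.
apply: le_trans (le_trans main _).
  rewrite lee_fin ler_pM2l ?invr_gt0// ler_expR lerN2.
  rewrite -(ler_pM2r sig2) mulfVK ?gt_eqF//.
  have -> : m%:R * ((2 * lam) ^+ 2 * s2 / 2) * sigma ^+ 2 =
      2 * m%:R * lam * (lam * sigma ^+ 2) * s2 by field.
  rewrite lamS.
  apply: (@le_trans _ _ (2 * m%:R * lam * (100 * nu) * (kappa * sigma ^+ 2))).
    by rewrite ler_wpM2l ?mulr_ge0 ?ler0n ?(ltW lam0) ?(ltW nu0).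
  have -> : 2 * m%:R * lam * (100 * nu) * (kappa * sigma ^+ 2) =
     (2 * 100 ^+ 2 * kappa * nu) * (m%:R * nu).
    rewrite (_ : _ * _ * _ = 2 * m%:R * (lam * sigma ^+ 2) * (100 * nu) * kappa); last by ring.
    by rewrite lamS; ring.
  (* The constant [200 ^+ 2] is [2 * 100 ^+ 2] from the exponent at [2 * lam], times 2 from
     [m * nu <= 2 * C]. *)
  have -> : 200 ^+ 2 * kappa * nu * C = (2 * 100 ^+ 2 * kappa * nu) * (2 * C) by ring.
  by rewrite ler_wpM2l ?mulr_ge0 ?exprn_ge0 ?ler0n ?kappa_ge0 ?(ltW nu0).
by rewrite /J; under eq_set do rewrite big_map.
Qed.

(** Both regimes of the theorem are instances, with [nu] equal to [sigma ^+ 2 / C] or to [mu]. The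
    factor [1/32] collects [1/4] from the deficit probability, [1/4] from [eps_tot_ge] and [1/2]
    from [m <= 2 * C / nu]. *)
Lemma eps_tot_liminf_ge (C nu : R) (o : int -> bool) (Y W B F : int -> nat -> T -> R) :
  0 < C -> 0 < nu -> mu <= nu -> sigma ^+ 2 <= nu * C ->
  32 * kappa * (100 * nu) <= sigma -> nu <= C ->
  control_scheme 0 o Z Y W B F ->
  ((nu / 32 * expR (- (200 ^+ 2 * kappa * nu * C / sigma ^+ 2)))%:E <=
   limn_einf (eps_tot P C W F))%E.
Proof.
move=> C0 nu0 munu nuC nusigma nuC1 [mY [mW [mB [mF [B0 [BY [BS bal]]]]]]].
(* Zero capacity forces [B = 0], hence [Y = 0]: the balance no longer links different time slots. *)
have Bz i t w : B i t w = 0 by apply/eqP; rewrite eq_le andbC.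
have Yz i t w : Y i t w = 0 by have := BY i t w; rewrite !Bz add0r => <-.
pose m := (Num.truncn (C / nu)).+1.
have Cnu : 1 <= C / nu by rewrite ler_pdivlMr// mul1r.
have m0 : (0 < m)%N by [].
have mC : C <= m%:R * nu by rewrite -ler_pdivrMr// ltW// truncnS_gt.
have m2C : m%:R * nu <= 2 * C.
  rewrite -ler_pdivlMr// -mulrA (_ : m%:R = (Num.truncn (C / nu))%:R + 1); last by rewrite natr1.
  have : (Num.truncn (C / nu))%:R <= C / nu by rewrite truncn_le// (le_trans _ Cnu).
  by lra.
pose p := 4^-1 * expR (- (200 ^+ 2 * kappa * nu * C / sigma ^+ 2)).
have p0 : 0 < p by rewrite mulr_gt0 ?expR_gt0// invr_gt0.
apply: (@limn_einf_ge _ _ _ (2 * m + 2)) => n mn.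
have mR : 0 < m%:R :> R by rewrite ltr0n.
apply: (@le_trans _ _ (C * p / (4 * m%:R))%:E).
  rewrite lee_fin ler_pdivlMr ?mulr_gt0// /p.
  set e := expR _; have e0 : 0 < e by exact: expR_gt0.
  have : e * (m%:R * nu) <= e * (2 * C) by rewrite ler_pM2l.
  by lra.
apply: eps_tot_ge => //; first by rewrite mulr_ge0 ?ltW.
move=> t k.
pose w_ (i : nat) := ('E_P[fun w => negpart (W i%:Z t w)])%E.
pose e_ (i : nat) := ('E_P[fun w => overflow C (F i%:Z t w)])%E.
have w0 i : (0 <= w_ i)%E by apply: expectation_ge0 => w; exact: negpart_ge0.
have e0 i : (0 <= e_ i)%E by apply: expectation_ge0 => w; exact: overflow_ge0.
apply: le_trans (@sum_disjoint_blocks R w_ e_ (C * p) m k m0 w0 e0 _).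
  by rewrite leeDl.
(* [g] is the flow counted from left to right. *)
move=> a; pose g (i : nat) w := orient_sign o i%:Z * F i%:Z t w.
have eg i : e_ i = ('E_P[fun w => overflow C (g i w)])%E.
  congr expectation; apply/funext => w; rewrite /g /orient_sign.
  by case: ifP => _; rewrite ?mul1r// mulN1r overflowN.
rewrite !eg; apply: (@expected_block_shortfall _ _ _ P C (fun i : nat => W i%:Z t)
  (fun i : nat => Z i%:Z t) g a m p) => //.
- by move=> i; apply: measurable_funM.
- move=> i w; have := bal i.+1%:Z t w; rewrite Yz subr0 /g.
  rewrite (_ : i.+1%:Z - 1 = i%:Z); last by lia.
  by lra.
- exact: block_lower_tail.
Qed.

End iid_grid.

(** * Choice of the constants and the two regimes *)

Theorem mainTheorem4 (R : realType) (kappa : R) (hkappa : 1 <= kappa) :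
  exists kappa0 kappa1 kappa2 : R,
    0 < kappa0 /\ 0 < kappa1 /\ 0 < kappa2 /\
    forall (d : measure_display) (T : measurableType d) (P : probability T R)
      (C mu sigma : R) (Z : int -> nat -> T -> R),
      0 < C ->
      (forall i t, measurable_fun setT (Z i t)) ->
      mutually_independent P (fun it : int * nat => Z it.1 it.2) ->
      (forall i t, same_distribution P (Z i t) (Z 0%Z 0%N)) ->
      in_S P kappa (Z 0%Z 0%N) ->
      ('E_P[Z 0%Z 0%N] = mu%:E)%E -> 0 <= mu ->
      ('V_P[Z 0%Z 0%N] = (sigma ^+ 2)%:E)%E -> 0 < sigma ->
      mu < kappa0 * sigma -> sigma < kappa0 * C ->
      forall (o : int -> bool) (Y W B F : int -> nat -> T -> R),
        control_scheme 0 o Z Y W B F ->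
        ((if mu < sigma ^+ 2 / C then kappa1 * sigma ^+ 2 / C
          else mu * expR (- (kappa2 * mu * C / sigma ^+ 2)))%:E
         <= limn_einf (eps_tot P C W F))%E.
Proof.
have k0 : 0 < 32 * kappa * 100 by lra.
(* The first constant yields [32 * kappa * (100 * nu) <= sigma] for both values of [nu]. The second
   is the bound at [nu * C = sigma ^+ 2]. *)
exists (32 * kappa * 100)^-1, (expR (- (200 ^+ 2 * kappa)) / 32), (200 ^+ 2 * kappa + 32).
split; first by rewrite invr_gt0.
split; first by rewrite divr_gt0 ?expR_gt0.
split; first by lra.
move=> d T P C mu sigma Z C0 mZ indep same inS EZ mu0 VZ sigma0.
rewrite -![_ < (32 * kappa * 100)^-1 * _](ltr_pM2l k0) !mulVKf ?gt_eqF// => hmu hsigma o Y W B F cs.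
have sig2 : 0 < sigma ^+ 2 by rewrite exprn_gt0.
have sigmaC : sigma <= C.
  apply: le_trans (ltW hsigma); rewrite ler_peMl ?ltW//; lra.
case: ifPn => [small|]; last rewrite -leNgt => large.
- have nu0 : 0 < sigma ^+ 2 / C by rewrite divr_gt0.
  have nuC : sigma ^+ 2 / C * C = sigma ^+ 2 by rewrite mulfVK// gt_eqF.
  apply: le_trans (@eps_tot_liminf_ge _ _ _ P kappa mu sigma Z mZ indep same inS
    EZ VZ hkappa sigma0 C (sigma ^+ 2 / C) o Y W B F C0 nu0 (ltW small) _ _ _ cs).
  + rewrite lee_fin -[_ * (_ / C) * C]mulrA nuC mulfK ?gt_eqF//.
    by rewrite le_eqVlt; apply/orP; left; apply/eqP; ring.
  + by rewrite nuC.
  + rewrite (_ : _ * _ = 32 * kappa * 100 * sigma * sigma / C); last by ring.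
    by rewrite ler_pdivrMr// [sigma * C]mulrC ler_pM2r// ltW.
  + by rewrite ler_pdivrMr// -expr2 lerXn2r// nnegrE ltW.
- have mu_gt0 : 0 < mu by apply: lt_le_trans large; rewrite divr_gt0.
  have large' : sigma ^+ 2 <= mu * C by rewrite -ler_pdivrMr.
  apply: le_trans (@eps_tot_liminf_ge _ _ _ P kappa mu sigma Z mZ indep same inS
    EZ VZ hkappa sigma0 C mu o Y W B F C0 mu_gt0 (lexx _) large' _ _ cs).
  + rewrite lee_fin -[leRHS]mulrA ler_pM2l//.
    have x1 : 1 <= mu * C / sigma ^+ 2 by rewrite ler_pdivlMr// mul1r.
    (* The surplus 32 in the third constant absorbs the prefactor: [expR (- (32 * x)) <= 1/32] for
       [x = mu * C / sigma ^+ 2 >= 1]. *)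
    rewrite (_ : - ((200 ^+ 2 * kappa + 32) * mu * C / sigma ^+ 2) =
      - (32 * (mu * C / sigma ^+ 2)) + - (200 ^+ 2 * kappa * mu * C / sigma ^+ 2)); last by ring.
    rewrite expRD ler_wpM2r ?expR_ge0// expRN lef_pV2 ?posrE ?expR_gt0//.
    by apply: le_trans (expR_ge1Dx _); lra.
  + by rewrite mulrA ltW.
  + by apply: le_trans sigmaC; apply: le_trans (ltW hmu); rewrite ler_peMl//; lra.
Qed.
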